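(* Let $\lambda$ be a nonzero real number and $r$ a positive integer. For every integer $n\ge0$ (and every real $x$), $$\sum_{k=0}^{n}\frac{\binom{n}{k}S_{1,\lambda}(k+r+1,r+1)}{\binom{k+r+1}{k}}\,C_{n-k}^{(r)}(x-1)=\sum_{l=0}^{n}\binom{n}{l}\,l!\,H_{\lambda}(l+r+1,r)\,(-1)^{l}\,C_{n-l}^{(r)}(x).$$
   Context: All generating functions are formal power series in $t$ with real coefficients. For $x\in\mathbb{R}$: $(x)_0=1$, $(x)_n=x(x-1)\cdots(x-n+1)$ for $n\ge1$; $(x)_{0,\lambda}=1$, $(x)_{n,\lambda}=x(x-\lambda)\cdots(x-(n-1)\lambda)$ for $n\ge 1$. The degenerate logarithm is $\log_\lambda(1+t)=\frac{1}{\lambda}\left((1+t)^\lambda-1\right)$. The degenerate Stirling numbers of the first kind $S_{1,\lambda}(n,l)$ are defined by $(x)_n=\sum_{l=0}^n S_{1,\lambda}(n,l)(x)_{l,\lambda}$ (polynomial identity in $x$, $n\ge0$). The generalized degenerate harmonic numbers $H_\lambda(n+r+1,r)$ ($n\ge0$) are defined by $\sum_{n\ge0}H_\lambda(n+r+1,r)t^n=\frac{\left(-\log_\lambda(1-t)\right)^{r+1}}{t^{r+1}(1-t)}$. The type 2 Changhee polynomials of order $r$ are defined by $\left(\frac{2}{(1+t)+(1+t)^{-1}}\right)^r(1+t)^x=\sum_{n\ge0}C_n^{(r)}(x)\frac{t^n}{n!}$. *)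

(* Defs.v *)
From HB Require Import structures.
From mathcomp Require Import all_boot all_order all_algebra.
From mathcomp Require Import boolp reals.

Set Implicit Arguments.
Unset Strict Implicit.
Unset Printing Implicit Defensive.

Import GRing.Theory Num.Theory.
Local Open Scope ring_scope.

(* Formal power series over a field, given by their coefficient sequences, as
   a commutative unit ring and an algebra over the field.  A series is a unit
   iff its constant term is nonzero; the inverse of a non-unit is itself, as
   always in MathComp. *)
Record fps (K : fieldType) := Fps { fcoef :> nat -> K }.

HB.instance Definition _ (K : fieldType) := gen_eqMixin (fps K).
HB.instance Definition _ (K : fieldType) := gen_choiceMixin (fps K).

Lemma fpsP (K : fieldType) (f g : fps K) : (forall n, f n = g n) -> f = g.
Proof. by case: f g => [f] [g] /= fg; congr Fps; apply: funext. Qed.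

Definition fps_zero (K : fieldType) : fps K := Fps (fun=> 0).
Definition fps_one (K : fieldType) : fps K := Fps (fun n => (n == 0)%:R).
Definition fps_opp (K : fieldType) (f : fps K) : fps K := Fps (fun n => - f n).
Definition fps_add (K : fieldType) (f g : fps K) : fps K :=
  Fps (fun n => f n + g n).
Definition fps_mul (K : fieldType) (f g : fps K) : fps K :=
  Fps (fun n => \sum_(i < n.+1) f i * g (n - i)%N).
Definition fps_scale (K : fieldType) (a : K) (f : fps K) : fps K :=
  Fps (fun n => a * f n).

Lemma fps_addA (K : fieldType) : associative (@fps_add K).
Proof. by move=> f g h; apply: fpsP => n; apply: addrA. Qed.
Lemma fps_addC (K : fieldType) : commutative (@fps_add K).
Proof. by move=> f g; apply: fpsP => n; apply: addrC. Qed.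
Lemma fps_add0 (K : fieldType) : left_id (fps_zero K) (@fps_add K).
Proof. by move=> f; apply: fpsP => n; apply: add0r. Qed.
Lemma fps_addN (K : fieldType) :
  left_inverse (fps_zero K) (@fps_opp K) (@fps_add K).
Proof. by move=> f; apply: fpsP => n; apply: addNr. Qed.

HB.instance Definition _ (K : fieldType) :=
  GRing.isZmodule.Build (fps K)
    (@fps_addA K) (@fps_addC K) (@fps_add0 K) (@fps_addN K).

Definition fps_trunc (K : fieldType) (n : nat) (f : fps K) : {poly K} :=
  \poly_(i < n.+1) f i.

Lemma fps_mul_trunc (K : fieldType) (f g : fps K) (m n : nat) :
  (n <= m)%N -> fps_mul f g n = (fps_trunc m f * fps_trunc m g)`_n.
Proof.
move=> nm; rewrite coefM; apply: eq_bigr => i _.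
rewrite !coef_poly !ltnS (leq_trans (leq_subr _ _) nm).
by rewrite (leq_trans _ nm) // -ltnS.
Qed.

Lemma fps_mulA (K : fieldType) : associative (@fps_mul K).
Proof.
move=> f g h; apply: fpsP => n.
transitivity (fps_trunc n f * (fps_trunc n g * fps_trunc n h))`_n.
  rewrite coefM; apply: eq_bigr => i _.
  by rewrite (@fps_mul_trunc _ g h n) ?leq_subr // coef_poly ltn_ord.
rewrite mulrA coefM; apply: eq_bigr => i _.
rewrite (@fps_mul_trunc _ f g n); last by rewrite -ltnS.
by rewrite coef_poly ltnS leq_subr.
Qed.
Lemma fps_mulC (K : fieldType) : commutative (@fps_mul K).
Proof.
by move=> f g; apply: fpsP => n; rewrite !(@fps_mul_trunc _ _ _ n) // mulrC.
Qed.
Lemma fps_mul1 (K : fieldType) : left_id (fps_one K) (@fps_mul K).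
Proof.
move=> f; apply: fpsP => n /=; rewrite big_ord_recl /= mul1r subn0 big1 ?addr0 //.
by move=> i _; rewrite mul0r.
Qed.
Lemma fps_mulD (K : fieldType) : left_distributive (@fps_mul K) (@fps_add K).
Proof.
move=> f g h; apply: fpsP => n /=; rewrite -big_split.
by apply: eq_bigr => i _; apply: mulrDl.
Qed.
Lemma fps_one_neq0 (K : fieldType) : fps_one K != 0.
Proof.
apply/eqP => /(congr1 (fun f : fps K => f 0%N)) /eqP; apply/negP.
exact: oner_neq0.
Qed.

HB.instance Definition _ (K : fieldType) :=
  GRing.Zmodule_isComNzRing.Build (fps K)
    (@fps_mulA K) (@fps_mulC K) (@fps_mul1 K) (@fps_mulD K) (@fps_one_neq0 K).

Lemma fps_scaleA (K : fieldType) (a b : K) (f : fps K) :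
  fps_scale a (fps_scale b f) = fps_scale (a * b) f.
Proof. by apply: fpsP => n; apply: mulrA. Qed.
Lemma fps_scale1 (K : fieldType) : left_id 1 (@fps_scale K).
Proof. by move=> f; apply: fpsP => n; apply: mul1r. Qed.
Lemma fps_scaleDr (K : fieldType) : right_distributive (@fps_scale K) +%R.
Proof. by move=> a f g; apply: fpsP => n; apply: mulrDr. Qed.
Lemma fps_scaleDl (K : fieldType) (f : fps K) :
  {morph (@fps_scale K)^~ f : a b / a + b}.
Proof. by move=> a b; apply: fpsP => n; apply: mulrDl. Qed.

HB.instance Definition _ (K : fieldType) :=
  GRing.Zmodule_isLmodule.Build K (fps K)
    (@fps_scaleA K) (@fps_scale1 K) (@fps_scaleDr K) (@fps_scaleDl K).

Lemma fps_scaleAl (K : fieldType) (a : K) (f g : fps K) :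
  a *: (f * g) = (a *: f) * g.
Proof.
apply: fpsP => n; rewrite [LHS]mulr_sumr.
by apply: eq_bigr => i _; apply: mulrA.
Qed.

HB.instance Definition _ (K : fieldType) :=
  GRing.Lmodule_isLalgebra.Build K (fps K) (@fps_scaleAl K).
HB.instance Definition _ (K : fieldType) :=
  GRing.Lalgebra_isComAlgebra.Build K (fps K).

(* [fps_inv_seq f n] lists the coefficients of orders n, ..., 0 of 1 / f. *)
Fixpoint fps_inv_seq (K : fieldType) (f : fps K) (n : nat) : seq K :=
  if n is m.+1 then
    let s := fps_inv_seq f m in
    - (f 0)^-1 * (\sum_(i < n) f i.+1 * s`_i) :: s
  else [:: (f 0)^-1].

Definition fps_unit (K : fieldType) : {pred fps K} := fun f => f 0 != 0.
Definition fps_inv (K : fieldType) (f : fps K) : fps K :=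
  if f \in @fps_unit K then Fps (fun n => head 0 (fps_inv_seq f n)) else f.

Lemma fps_inv_seqE (K : fieldType) (f : fps K) (n i : nat) : (i <= n)%N ->
  (fps_inv_seq f n)`_i = head 0 (fps_inv_seq f (n - i)).
Proof.
elim: n i => [|n IHn] [|i] //= lein.
by rewrite IHn.
Qed.

Lemma fps_mulVf (K : fieldType) :
  {in @fps_unit K, left_inverse 1 (@fps_inv K) *%R}.
Proof.
move=> f uf; rewrite mulrC /fps_inv uf; apply: fpsP => -[|n].
  by rewrite [LHS]big_ord1 /= divff.
rewrite [LHS]big_ord_recl /= mulrA mulrN divff // mulN1r; apply/eqP.
rewrite addrC subr_eq0; apply/eqP/eq_bigr => i _.
by rewrite /bump /= add1n subSS fps_inv_seqE // -ltnS.
Qed.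
Lemma fps_unitPl (K : fieldType) (f g : fps K) : g * f = 1 -> fps_unit f.
Proof.
move=> /(congr1 (fun h : fps K => h 0%N)); rewrite [LHS]big_ord1 /= => gf1.
by apply/eqP => f0; move/eqP: gf1; rewrite f0 mulr0 eq_sym oner_eq0.
Qed.
Lemma fps_inv_out (K : fieldType) :
  {in [predC @fps_unit K], @fps_inv K =1 id}.
Proof. by move=> f; rewrite inE /fps_inv => /negbTE ->. Qed.

HB.instance Definition _ (K : fieldType) :=
  GRing.ComNzRing_hasMulInverse.Build (fps K)
    (@fps_mulVf K) (@fps_unitPl K) (@fps_inv_out K).

Lemma fps_unitE (K : fieldType) (f : fps K) :
  (f \is a GRing.unit) = (f 0 != 0).
Proof. by []. Qed.

(* The indeterminate t. *)
Definition fps_t (K : fieldType) : fps K := Fps (fun n => (n == 1)%:R).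

(* f(-t) *)
Definition fps_negt (K : fieldType) (f : fps K) : fps K :=
  Fps (fun n => (-1) ^+ n * f n).

(* f / t^k, meant for f divisible by t^k; since t^k is not a unit, this is not
   a division in the unit ring [fps K]. *)
Definition fps_divt (K : fieldType) (k : nat) (f : fps K) : fps K :=
  Fps (fun n => f (n + k)%N).

(* (x)_n and (x)_{n,lam}; the ring A is R, or {poly R} when x is 'X. *)
Definition falling (A : comNzRingType) (x : A) (n : nat) : A :=
  \prod_(i < n) (x - i%:R).
Definition dfalling (A : comNzRingType) (lam x : A) (n : nat) : A :=
  \prod_(i < n) (x - i%:R * lam).

(* (1 + t)^x, as the binomial series. *)
Definition binomial_series (R : realType) (x : R) : fps R :=
  Fps (fun n => falling x n / n`!%:R).

(* log_lam(1 + t) *)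
Definition dlog (R : realType) (lam : R) : fps R :=
  lam^-1 *: (binomial_series lam - 1).

Definition is_dstirling1 (R : realType) (lam : R) (S : nat -> nat -> R) :=
  forall n : nat,
    falling ('X : {poly R}) n = \sum_(l < n.+1) S n l *: dfalling lam%:P 'X l.

Fixpoint dstirling1_rec (R : realType) (lam : R) (n l : nat) : R :=
  if n is m.+1 then
    (if l is k.+1 then dstirling1_rec lam m k else 0)
    + (l%:R * lam - m%:R) * dstirling1_rec lam m l
  else (l == 0)%:R.

Lemma dstirling1_exists (R : realType) (lam : R) :
  exists S : nat -> nat -> R, is_dstirling1 lam S.
Proof.
exists (dstirling1_rec lam).
have S0 n l : (n < l)%N -> dstirling1_rec lam n l = 0.
  elim: n l => [|n IHn] [|l] //= nl.
  by rewrite !IHn ?mulr0 ?addr0 // ltnW.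
elim=> [|n IHn].
  by rewrite big_ord1 /falling /dfalling !big_ord0 /= scale1r.
rewrite /falling big_ord_recr /= -/(falling _ _) IHn mulr_suml.
under [RHS]eq_bigr => i _ do rewrite scalerDl.
rewrite big_split /= [X in _ = X + _]big_ord_recl /= scale0r add0r.
rewrite [X in _ = _ + X]big_ord_recr /= S0 // mulr0 scale0r addr0 -big_split /=.
apply: eq_bigr => i _; rewrite /dfalling big_ord_recr /= -/(dfalling _ _ _).
rewrite [_ * dstirling1_rec _ _ _]mulrC -scalerA -scalerDr -scalerAl.
congr (_ *: _); rewrite -[_ *: dfalling _ _ _]mul_polyC polyCB polyCM !polyC_natr.
by rewrite [X in _ = _ + X]mulrC -mulrDr addrA subrK.
Qed.

Lemma dstirling1_unique (R : realType) (lam : R) (S S' : nat -> nat -> R) :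
  is_dstirling1 lam S -> is_dstirling1 lam S' ->
  forall n l, (l <= n)%N -> S n l = S' n l.
Proof.
move=> hS hS' n l ln.
have Dm k : dfalling lam%:P 'X k \is monic /\
            size (dfalling lam%:P ('X : {poly R}) k) = k.+1.
  have E : dfalling lam%:P ('X : {poly R}) k
           = \prod_(i < k) ('X - (i%:R * lam)%:P).
    by apply: eq_bigr => i _; rewrite polyCM polyC_natr.
  by rewrite E monic_prod_XsubC size_prod_XsubC -sum1_size sum1_card card_ord.
suff H m (c : nat -> R) : \sum_(i < m) c i *: dfalling lam%:P ('X : {poly R}) i = 0 ->
    forall i, (i < m)%N -> c i = 0.
  apply/eqP; rewrite -subr_eq0; apply/eqP.
  apply: (H n.+1 (fun i => S n i - S' n i)); last by rewrite ltnS.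
  under eq_bigr => i _ do rewrite scalerBl.
  by rewrite sumrB -hS -hS' subrr.
elim: m => [//|m IHm] hc i.
have cm : c m = 0.
  move/(congr1 (fun p : {poly R} => p`_m)): hc.
  rewrite big_ord_recr /= coefD coefZ coef_sum big1 => [|j _].
    have [/monicP + sD] := Dm m; rewrite /lead_coef sD /= => ->.
    by rewrite add0r mulr1 coef0.
  by rewrite coefZ nth_default ?mulr0 // (Dm j).2 ltn_ord.
rewrite ltnS leq_eqVlt => /orP [/eqP -> //|im].
by apply: IHm => //; move: hc; rewrite big_ord_recr /= cm scale0r addr0.
Qed.

(* S_{1,lam}(n, l), chosen by its defining identity, which determines it by
   [dstirling1_unique]; meaningful for l <= n only. *)
Definition dstirling1 (R : realType) (lam : R) : nat -> nat -> R :=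
  projT1 (cid (dstirling1_exists lam)).

Lemma dstirling1P (R : realType) (lam : R) : is_dstirling1 lam (dstirling1 lam).
Proof. exact: projT2 (cid (dstirling1_exists lam)). Qed.

(* H_lam(m, r), meaningful for m >= r + 1 only: H_lam(n + r + 1, r) is the
   coefficient of t^n in (- log_lam(1 - t))^(r+1) / (t^(r+1) (1 - t)). *)
Definition dharmonic (R : realType) (lam : R) (m r : nat) : R :=
  (fps_divt r.+1 ((- fps_negt (dlog lam)) ^+ r.+1) / (1 - fps_t R)) (m - r.+1)%N.

Lemma dharmonicP (R : realType) (lam : R) (r : nat) :
  Fps (fun n => dharmonic lam (n + r + 1) r) * (fps_t R ^+ r.+1 * (1 - fps_t R))
  = (- fps_negt (dlog lam)) ^+ r.+1.
Proof.
set L := - fps_negt _.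
have tXE k (f : fps R) n : (fps_t R ^+ k * f) n = if (k <= n)%N then f (n - k)%N else 0.
  elim: k n => [|k IHk] n; first by rewrite mul1r subn0.
  rewrite exprS -mulrA; case: n => [|n].
    by rewrite [LHS]big_ord1 /= mul0r.
  rewrite [LHS]big_ord_recl /= mul0r add0r big_ord_recl /= mul1r.
  rewrite [X in _ + X]big1 => [|i _]; last by rewrite mul0r.
  by rewrite addr0 /bump /= subn1 -[LHS]/((fps_t R ^+ k * f) n) IHk.
have E : Fps (fun n => dharmonic lam (n + r + 1) r)
         = fps_divt r.+1 (L ^+ r.+1) / (1 - fps_t R).
  by apply: fpsP => n; rewrite [LHS]/= /dharmonic -addnA addn1 addnK.
have U : 1 - fps_t R \is a GRing.unit.
  by rewrite fps_unitE /= subr0 oner_neq0.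
rewrite E [_ * (1 - _)]mulrC mulrA divrK // mulrC.
have L0 : L 0 = 0.
  rewrite /L [LHS]/= /falling big_ord0 fact0 divr1 subrr.
  by rewrite !mulr0 oppr0.
have LE : L = fps_t R * fps_divt 1 L.
  apply: fpsP => n; rewrite -[fps_t R]expr1 tXE.
  by case: n => [|n]; rewrite //= ?subn1 ?addn1.
apply: fpsP => n; rewrite tXE; case: ifP => rn; first by rewrite /= subnK.
by rewrite LE exprMn tXE rn.
Qed.

(* C_n^(r)(x), the type 2 Changhee polynomial of order r, read off from its
   exponential generating function. *)
Definition changhee2 (R : realType) (r n : nat) (x : R) : R :=
  n`!%:R *
  ((2 / ((1 + fps_t R) + (1 + fps_t R)^-1)) ^+ r * binomial_series x) n.

Lemma changhee2_unit (R : realType) :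
  (1 + fps_t R \is a GRing.unit) &&
  ((1 + fps_t R) + (1 + fps_t R)^-1 \is a GRing.unit).
Proof.
have U : 1 + fps_t R \is a GRing.unit.
  by rewrite fps_unitE /= addr0 oner_neq0.
rewrite U /=.
have : ((1 + fps_t R) * (1 + fps_t R)^-1) 0 = 1 by rewrite divrr.
rewrite [LHS]big_ord1 /= addr0 mul1r => V0.
by rewrite fps_unitE /= addr0 V0 -[1 + 1]/(2 : R) pnatr_eq0.
Qed.

(* Main.v *)
(** Put [m = r + 1] and [L = log_lam (1 + t)].  Since
    [(1 + t) * L' = 1 + lam * L], the coefficients of [L ^+ l] obey the
    recurrence of [S_{1,lam}(n, l) * l! / n!]; hence the series
    [F = \sum_k S_{1,lam}(k + m, m) * m! / (k + m)! * t^k] satisfies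
    [t^m * F = L ^+ m].  Substituting [- t] for [t] in the definition of the
    harmonic numbers gives [t^m * (1 + t) * H(- t) = L ^+ m], where [H] is their
    generating series, so [F = (1 + t) * H(- t)].  Multiply by the generating
    series of the Changhee polynomials at [x - 1], and absorb the factor [1 + t]
    into [(1 + t)^(x - 1)]. *)
Require Import Defs.
From mathcomp Require Import all_boot all_order all_algebra.
From mathcomp Require Import ring.
From mathcomp Require Import boolp reals.

Import GRing.Theory Num.Theory.
Local Open Scope ring_scope.

(** * Coefficients of products, powers of [t], and the substitution of [- t] *)

Lemma fps_coefM {K : fieldType} (f g : fps K) (n : nat) :
  (f * g) n = \sum_(i < n.+1) f i * g (n - i)%N.
Proof. by []. Qed.

Lemma fps_coefMn {K : fieldType} (f : fps K) (n m : nat) :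
  (f *+ n) m = f m *+ n.
Proof. by elim: n => [//|n IHn]; rewrite !mulrS -IHn. Qed.

Lemma fps_coef_tM {K : fieldType} (f : fps K) (n : nat) :
  (fps_t K * f) n = if n is m.+1 then f m else 0.
Proof.
case: n => [|n]; first by rewrite fps_coefM big_ord1 mul0r.
rewrite fps_coefM 2!big_ord_recl big1 /= => [|i _]; last by rewrite mul0r.
by rewrite mul0r add0r mul1r addr0 subn1.
Qed.

Lemma fps_coef_tXM {K : fieldType} (f : fps K) (m n : nat) :
  (fps_t K ^+ m * f) (n + m)%N = f n.
Proof.
elim: m => [|m IHm]; first by rewrite mul1r addn0.
by rewrite exprS -mulrA fps_coef_tM addnS.
Qed.

Lemma fps_tX_inj {K : fieldType} (m : nat) :
  injective ( *%R (fps_t K ^+ m)).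
Proof.
by move=> f g fg; apply: fpsP => n; rewrite -(fps_coef_tXM f m) fg fps_coef_tXM.
Qed.

Lemma fps_negtM {K : fieldType} (f g : fps K) :
  fps_negt (f * g) = fps_negt f * fps_negt g.
Proof.
apply: fpsP => n; rewrite fps_coefM [LHS]/= mulr_sumr.
apply: eq_bigr => i _ /=.
by rewrite mulrACA -exprD subnKC // -ltnS.
Qed.

Lemma fps_negt1 {K : fieldType} : fps_negt (1 : fps K) = 1.
Proof. by apply: fpsP => -[|n] /=; rewrite ?mulr0 // mulr1. Qed.

Lemma fps_negtX {K : fieldType} (f : fps K) (m : nat) :
  fps_negt (f ^+ m) = fps_negt f ^+ m.
Proof.
by elim: m => [|m IHm]; rewrite ?expr0 ?fps_negt1 // !exprS fps_negtM IHm.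
Qed.

Lemma fps_negtN {K : fieldType} (f : fps K) : fps_negt (- f) = - fps_negt f.
Proof. by apply: fpsP => n; rewrite /= mulrN. Qed.

Lemma fps_negtD {K : fieldType} (f g : fps K) :
  fps_negt (f + g) = fps_negt f + fps_negt g.
Proof. by apply: fpsP => n; rewrite /= mulrDr. Qed.

Lemma fps_negtK {K : fieldType} : involutive (@fps_negt K).
Proof. by move=> f; apply: fpsP => n /=; rewrite mulrA -expr2 sqrr_sign mul1r. Qed.

Lemma fps_negt_t {K : fieldType} : fps_negt (fps_t K) = - fps_t K.
Proof.
by apply: fpsP => -[|[|n]] /=; rewrite ?mulr0 ?oppr0 // mulr1.
Qed.

(* The Euler operator [t d/dt]; unlike [d/dt] it does not shift coefficients,
   which makes the Leibniz rule a termwise identity. *)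
Definition fps_euler {K : fieldType} (f : fps K) : fps K :=
  Fps (fun n => n%:R * f n).

Lemma fps_eulerM {K : fieldType} (f g : fps K) :
  fps_euler (f * g) = fps_euler f * g + f * fps_euler g.
Proof.
apply: fpsP => n; rewrite [LHS]/= mulr_sumr -[RHS]big_split.
apply: eq_bigr => i _ /=.
(* The weight [n] splits into one share for each factor. *)
have {1}-> : n = (i + (n - i))%N by rewrite subnKC // -ltnS.
by rewrite natrD; ring.
Qed.

Lemma fps_eulerX {K : fieldType} (f : fps K) (l : nat) :
  fps_euler (f ^+ l.+1) = (f ^+ l * fps_euler f) *+ l.+1.
Proof.
elim: l => [|l IHl]; first by rewrite expr1 mul1r.
by rewrite exprS fps_eulerM IHl mulrnAr mulrA -exprS [_ * f ^+ _]mulrC -mulrS.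
Qed.

(** * Falling factorials and the binomial series *)

Lemma falling_recr {A : comNzRingType} (x : A) (n : nat) :
  falling x n.+1 = falling x n * (x - n%:R).
Proof. by rewrite /falling big_ord_recr. Qed.

Lemma falling_recl {A : comNzRingType} (x : A) (n : nat) :
  falling x n.+1 = x * falling (x - 1) n.
Proof.
rewrite /falling big_ord_recl subr0; congr (_ * _); apply: eq_bigr => i _.
by rewrite /bump /= natrD opprD addrA.
Qed.

Lemma natr_factS {R : realType} (n : nat) :
  (n.+1)`!%:R = n.+1%:R * n`!%:R :> R.
Proof. by rewrite factS natrM. Qed.

Lemma natr_fact_neq0 {R : realType} (n : nat) : n`!%:R != 0 :> R.
Proof. by rewrite pnatr_eq0 -lt0n fact_gt0. Qed.

Lemma binomial_series_coefS {R : realType} (x : R) (n : nat) :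
  n.+1%:R * binomial_series x n.+1 = (x - n%:R) * binomial_series x n.
Proof.
rewrite /= falling_recr natr_factS.
have n1 : n.+1%:R != 0 :> R by rewrite pnatr_eq0.
have nf := @natr_fact_neq0 R n.
by field; rewrite nf nat1r n1.
Qed.

Lemma binomial_seriesS {R : realType} (x : R) :
  (1 + fps_t R) * binomial_series (x - 1) = binomial_series x.
Proof.
apply: fpsP => n; rewrite mulrDl mul1r.
rewrite -[LHS]/(binomial_series (x - 1) n + (fps_t R * binomial_series (x - 1)) n).
rewrite fps_coef_tM; case: n => [|n]; first by rewrite addr0 /= /falling !big_ord0.
rewrite /= (falling_recl x) falling_recr natr_factS.
have n1 : n.+1%:R != 0 :> R by rewrite pnatr_eq0.
have nf := @natr_fact_neq0 R n.
by field; rewrite nf nat1r n1.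
Qed.

(** * Differential equations and powers of the degenerate logarithm *)

Lemma dlog0 {R : realType} (lam : R) : dlog lam 0 = 0.
Proof. by rewrite /= /falling big_ord0 fact0 divr1 subrr mulr0. Qed.

Lemma binomial_series_dlog {R : realType} {lam : R} : lam != 0 ->
  binomial_series lam = 1 + lam *: dlog lam.
Proof. by move=> lam0; rewrite scalerA divff // scale1r addrC subrK. Qed.

(** This is [t] times the equation [(1 + t) f' = x f]; on coefficients it is the recurrence
    [binomial_series_coefS]. *)
Lemma euler_binomial_series {R : realType} (x : R) :
  (1 + fps_t R) * fps_euler (binomial_series x)
  = x *: (fps_t R * binomial_series x).
Proof.
apply: fpsP => n; rewrite mulrDl mul1r.
rewrite -[LHS]/(fps_euler (binomial_series x) n
                + (fps_t R * fps_euler (binomial_series x)) n).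
rewrite -[RHS]/(x * (fps_t R * binomial_series x) n) !fps_coef_tM.
case: n => [|n]; first by rewrite /= mul0r mulr0 addr0.
rewrite -[fps_euler _ n.+1]/(n.+1%:R * binomial_series x n.+1).
by rewrite binomial_series_coefS -mulrDl subrK.
Qed.

Lemma euler_dlog {R : realType} {lam : R} : lam != 0 ->
  (1 + fps_t R) * fps_euler (dlog lam) = fps_t R * (1 + lam *: dlog lam).
Proof.
move=> lam0; rewrite -binomial_series_dlog //.
have -> : fps_euler (dlog lam) = lam^-1 *: fps_euler (binomial_series lam).
  apply: fpsP => -[|n] /=; first by rewrite !mul0r mulr0.
  by rewrite subr0 mulrCA.
by rewrite -scalerAr euler_binomial_series scalerA mulVf // scale1r.
Qed.

(** Obtained by comparing coefficients of [t^(n+1)] in [(1 + t) t (L^(l+1))' = (l + 1) t (L^l + lam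
    L^(l+1))], where [L = dlog lam]. *)
Lemma dlogX_coefS {R : realType} {lam : R} (l n : nat) : lam != 0 ->
  n.+1%:R * (dlog lam ^+ l.+1) n.+1
  = l.+1%:R * (dlog lam ^+ l) n
    + (l.+1%:R * lam - n%:R) * (dlog lam ^+ l.+1) n.
Proof.
move=> lam0.
have E : (1 + fps_t R) * fps_euler (dlog lam ^+ l.+1)
         = fps_t R * ((dlog lam ^+ l + lam *: dlog lam ^+ l.+1) *+ l.+1).
  rewrite fps_eulerX mulrnAr mulrCA euler_dlog // mulrnAr mulrCA.
  by rewrite mulrDr mulr1 -scalerAr -exprSr.
move/(congr1 (fun f : fps R => f n.+1)): E.
rewrite mulrDl mul1r fps_coef_tM fps_coefMn.
rewrite -[X in X = _ -> _]/(n.+1%:R * (dlog lam ^+ l.+1) n.+1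
                            + (fps_t R * fps_euler (dlog lam ^+ l.+1)) n.+1).
rewrite fps_coef_tM.
rewrite -[X in _ = X *+ _ -> _]/((dlog lam ^+ l) n + lam * (dlog lam ^+ l.+1) n).
rewrite -[fps_euler _ n]/(n%:R * (dlog lam ^+ l.+1) n) -mulr_natl.
by move/(canRL (addrK _)) ->; ring.
Qed.

Lemma dlogX_coef_eq0 {R : realType} {lam : R} (l n : nat) : lam != 0 ->
  (n < l)%N -> (dlog lam ^+ l) n = 0.
Proof.
move=> lam0; elim: n l => [|n IHn] [|l] // nl.
  by rewrite exprS fps_coefM big_ord1 dlog0 mul0r.
apply: (@mulfI _ n.+1%:R); first by rewrite pnatr_eq0.
by rewrite dlogX_coefS // (IHn l) // (IHn l.+1) ?(ltnW nl) // !mulr0 addr0.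
Qed.

(** * Degenerate Stirling numbers as coefficients of powers of [dlog lam] *)

Lemma dfallingS {A : comNzRingType} (lam x : A) (n : nat) :
  dfalling lam x n.+1 = dfalling lam x n * (x - n%:R * lam).
Proof. by rewrite /dfalling big_ord_recr. Qed.

(** Scaled by [n! / l!], the recurrence [dlogX_coefS] becomes the one produced by multiplying
    [(x)_{l,lam}] by [x - n = (x - l lam) + (l lam - n)]. *)
Lemma is_dstirling1_dlogX {R : realType} {lam : R} : lam != 0 ->
  is_dstirling1 lam (fun n l => n`!%:R / l`!%:R * (dlog lam ^+ l) n).
Proof.
move=> lam0.
set S := fun n l => _.
have SS n l : S n.+1 l.+1 = S n l + (l.+1%:R * lam - n%:R) * S n l.+1.
  have l1 : l.+1%:R != 0 :> R by rewrite pnatr_eq0.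
  have lf := @natr_fact_neq0 R l.
  have nf := @natr_fact_neq0 R n.
  transitivity (n`!%:R / l.+1`!%:R * (n.+1%:R * (dlog lam ^+ l.+1) n.+1)).
    by rewrite /S natr_factS; ring.
  by rewrite dlogX_coefS // /S natr_factS; field; rewrite lf nat1r l1.
(* [S n 0] vanishes for [n > 0], and the factor [n] covers [n = 0]. *)
have S0 n : n%:R * S n 0 = 0.
  by rewrite /S; case: n => [|n]; rewrite ?mul0r // expr0 !mulr0.
elim=> [|n IHn].
  by rewrite big_ord1 /falling /dfalling !big_ord0 /S divr1 mul1r scale1r.
rewrite falling_recr IHn mulr_suml.
have DS (l : nat) : dfalling lam%:P 'X l * ('X - n%:R)
    = dfalling lam%:P 'X l.+1 + (l%:R * lam - n%:R) *: dfalling lam%:P 'X l.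
  rewrite dfallingS -mul_polyC polyCB polyCM !polyC_natr; ring.
under eq_bigr => l _ do rewrite -scalerAl DS scalerDr scalerA.
rewrite big_split /= [RHS]big_ord_recl.
have -> : S n.+1 0 = 0 by rewrite /S expr0 mulr0.
rewrite scale0r add0r.
under [RHS]eq_bigr => l _ do rewrite /bump /= SS scalerDl.
rewrite big_split /=; congr (_ + _).
(* The two sums differ by a shift of index; the extra terms, [l = 0] on the left and [l = n + 1] on
   the right, are both zero. *)
rewrite big_ord_recl [RHS]big_ord_recr /=.
have -> : S n n.+1 = 0 by rewrite /S dlogX_coef_eq0 ?mulr0.
rewrite mul0r sub0r mulrN mulrC S0 oppr0 scale0r add0r mulr0 scale0r addr0.
by apply: eq_bigr => l _; rewrite mulrC.
Qed.

Lemma dstirling1E {R : realType} {lam : R} (n l : nat) : lam != 0 -> (l <= n)%N ->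
  dstirling1 lam n l = n`!%:R / l`!%:R * (dlog lam ^+ l) n.
Proof.
move=> lam0.
exact: dstirling1_unique (dstirling1P lam) (is_dstirling1_dlogX lam0) n l.
Qed.

(** * Harmonic numbers and the final comparison *)

Lemma dlogX_dharmonic {R : realType} (lam : R) (r : nat) :
  dlog lam ^+ r.+1 = fps_t R ^+ r.+1 *
    ((1 + fps_t R) * fps_negt (Fps (fun n => dharmonic lam (n + r + 1) r))).
Proof.
move/(congr1 (@fps_negt R)): (dharmonicP lam r).
rewrite fps_negtX fps_negtN fps_negtK !fps_negtM fps_negtX fps_negtD fps_negtN.
rewrite fps_negt1 fps_negt_t opprK (exprNn (dlog lam)) (exprNn (fps_t R)).
(* The powers of [- t] and of [- dlog lam] carry the same sign, a unit that cancels. *)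
rewrite -mulrA mulrCA => /(@mulrI _ ((-1) ^+ r.+1)) <- //.
  by rewrite mulrCA [fps_negt _ * _]mulrC.
by rewrite unitrX // unitrN1.
Qed.

(* Dividing by the binomial coefficient amounts to multiplying by
   [k! * (r + 1)! / (k + r + 1)!], which turns [dstirling1] into a coefficient
   of [dlog lam ^+ r.+1]. *)
Lemma dstirling1_dharmonic {R : realType} {lam : R} (r k : nat) : lam != 0 ->
  dstirling1 lam (k + r + 1) (r + 1) / 'C(k + r + 1, k)%:R
  = k`!%:R * ((1 + fps_t R)
      * fps_negt (Fps (fun n => dharmonic lam (n + r + 1) r))) k.
Proof.
move=> lam0.
rewrite -(fps_coef_tXM _ r.+1) -dlogX_dharmonic -!addnA !addn1.
move: r.+1 => {r} m.
rewrite dstirling1E ?leq_addl //.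
have := @bin_fact (k + m) k (leq_addr _ _).
rewrite addKn => /(congr1 (fun m => m%:R : R)); rewrite !natrM => <-.
have kf := @natr_fact_neq0 R k.
have mf := @natr_fact_neq0 R m.
have bf : 'C(k + m, k)%:R != 0 :> R.
  by rewrite pnatr_eq0 -lt0n bin_gt0 leq_addr.
by field; rewrite bf mf.
Qed.

(** The product rule for exponential generating functions, applied to both sides of the theorem. *)
Lemma binomial_convolution {R : realType} (n : nat) (f g : fps R) :
  \sum_(k < n.+1) 'C(n, k)%:R * (k`!%:R * f k) * ((n - k)`!%:R * g (n - k)%N)
  = n`!%:R * (f * g) n.
Proof.
rewrite fps_coefM mulr_sumr; apply: eq_bigr => k _.
by rewrite -(@bin_fact n k) -1?ltnS // !natrM; ring.
Qed.

Theorem mainTheorem9 (R : realType) (lam : R) (r : nat)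
    (hlam : lam != 0) (hr : (0 < r)%N) (n : nat) (x : R) :
  \sum_(k < n.+1)
     'C(n, k)%:R * dstirling1 lam (k + r + 1) (r + 1) / 'C(k + r + 1, k)%:R
       * changhee2 r (n - k) (x - 1)
  = \sum_(l < n.+1)
     'C(n, l)%:R * l`!%:R * dharmonic lam (l + r + 1) r * (-1) ^+ l
       * changhee2 r (n - l) x.
Proof.
set H := fps_negt (Fps (fun n => dharmonic lam (n + r + 1) r)).
set G := (2 / ((1 + fps_t R) + (1 + fps_t R)^-1)) ^+ r.
transitivity (n`!%:R * ((1 + fps_t R) * H * (G * binomial_series (x - 1))) n).
  rewrite -binomial_convolution; apply: eq_bigr => k _.
  by rewrite -[_ * _ / _]mulrA dstirling1_dharmonic.
(* The factor [1 + t] turns [(1 + t)^(x - 1)] into [(1 + t)^x]. *)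
transitivity (n`!%:R * (H * (G * binomial_series x)) n).
  congr (_ * (_ : fps R) n); rewrite -(binomial_seriesS x); ring.
rewrite -binomial_convolution; apply: eq_bigr => l _ /=.
by rewrite [(-1) ^+ l * _]mulrC !mulrA.
Qed.
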